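(* The elliptic fibration $t:\mathcal{X}\to\mathbf{P}^1$ over $\mathbf{Q}$ given by $y^2 = x^3 - 27 S(t)\, x + \frac{27}{4} T(t)$ has a fiber, over some rational value of $t$, that is an elliptic curve of rank at least $28$ over $\mathbf{Q}$.
   Context: The polynomials $S,T\in\mathbf{Z}[t]$ are $$\begin{aligned} S(t) ={}& 307516108335972163537936\,t^8 + 10476571005172375234427296\,t^7\\ & + 234256046667228607566274912\,t^6 + 2020678721371875903158954848\,t^5\\ & + 8789387383568632081365832240\,t^4 + 21430123310022469548285709072\,t^3\\ & + 28607402618712438778345257832\,t^2 + 17860826619093915900857289304\,t\\ & + 4201305425690184127251888481, \end{aligned}$$ $$\begin{aligned} T(t) ={}& 1050290276365892761266194577222156800\,t^{12}\\ & + 67802587761728815952013525763236564480\,t^{11}\\ & + 2392486076703808362288120169049836903680\,t^{10}\\ & + 38126035250980128714796491999580538771200\,t^9\\ & + 372202978476351718721663756748866085220800\,t^8\\ & + 2373760737463050257069464720014664373086080\,t^7\\ & + 9904246958414858348647761354992989326760320\,t^6\\ & + 26905633537996991160744810870319331164617600\,t^5\\ & + 47243082583908684509409509915652973906060800\,t^4\\ & + 52862444598312784274784438443066814490530880\,t^3\\ & + 36435013603665838306995466090052055171475872\,t^2\\ & + 13865015501478235534002649882546248548532768\,t\\ & + 2193201312876924214657300134273061462776968. \end{aligned}$$ The fiber over $t=t_0\in\mathbf{Q}$ is the curve $y^2 = x^3 - 27 S(t_0) x + \frac{27}{4}T(t_0)$ over $\mathbf{Q}$. *)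

(* Defs.v *)
From Stdlib Require Import ZArith.
From HB Require Import structures.
From mathcomp Require Import all_boot all_order all_algebra ring.
From mathcomp.zify Require Import ssrZ.

Set Implicit Arguments.
Unset Strict Implicit.
Unset Printing Implicit Defensive.

Import GRing.Theory.
Local Open Scope ring_scope.

Record weierstrass (F : fieldType) := Weierstrass { wa : F; wb : F }.

Definition discriminant (F : fieldType) (W : weierstrass F) : F :=
  - 16%:R * (4%:R * wa W ^+ 3 + 27%:R * wb W ^+ 2).

(* The factor 16 in the discriminant excludes characteristic 2, in which
   y^2 = x^3 + a x + b is always singular. *)
Record ellipticCurve (F : fieldType) := EllipticCurve {
  ec_weierstrass :> weierstrass F;
  ec_smooth : discriminant ec_weierstrass != 0
}.

Section PlanePoints.
Variables (F : fieldType) (W : weierstrass F).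

(* None is the point at infinity, Some (x, y) the affine point (x, y). *)
Definition on_curve (P : option (F * F)) : bool :=
  if P is Some (x, y) then y ^+ 2 == x ^+ 3 + wa W * x + wb W else true.

Definition pp_opp (P : option (F * F)) : option (F * F) :=
  if P is Some (x, y) then Some (x, - y) else None.

(* slope of the chord through P and Q, or of the tangent at P when the abscissas agree *)
Definition slope (P Q : F * F) : F :=
  if P.1 == Q.1 then (3%:R * P.1 ^+ 2 + wa W) / (2%:R * P.2)
  else (Q.2 - P.2) / (Q.1 - P.1).

Definition chord (l : F) (P Q : F * F) : F * F :=
  let x := l ^+ 2 - P.1 - Q.1 in (x, l * (P.1 - x) - P.2).

Definition pp_add (P Q : option (F * F)) : option (F * F) :=
  match P, Q with
  | None, _ => Q
  | _, None => P
  | Some P', Some Q' =>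
      if (P'.1 == Q'.1) && (P'.2 == - Q'.2) then None
      else Some (chord (slope P' Q') P' Q')
  end.

End PlanePoints.

Section GroupLaw.
Variables (F : fieldType) (E : ellipticCurve F).
Implicit Types (P Q R : option (F * F)).

Local Notation a := (wa E).
Local Notation b := (wb E).
Local Notation "P +' Q" := (pp_add E P Q) (at level 50, left associativity).
Local Notation "~- P" := (pp_opp P) (at level 35, right associativity).
Local Notation oc := (on_curve E).

Lemma pp_two_neq0 : 2%:R != 0 :> F.
Proof.
apply/eqP => h2; have /eqP := ec_smooth E; apply.
rewrite /discriminant; have -> : 16%:R = 2%:R ^+ 4 :> F by ring.
by rewrite h2 expr0n /= oppr0 mul0r.
Qed.

(* l is the slope of the line through two points whose sum is affine *)
Definition is_slope (l : F) (p q : F * F) :=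
  p.2 - q.2 = l * (p.1 - q.1) /\
  l * (p.2 + q.2) = p.1 ^+ 2 + p.1 * q.1 + q.1 ^+ 2 + a.

Lemma pp_same_x (p q : F * F) : oc (Some p) -> oc (Some q) -> p.1 = q.1 ->
  ~~ ((p.1 == q.1) && (p.2 == - q.2)) -> p = q /\ p.2 + q.2 != 0.
Proof.
case: p q => [x1 y1] [x2 y2] /= /eqP h1 /eqP h2 e; subst x2.
rewrite eqxx /= -addr_eq0 => ne; split=> //; congr pair; apply/eqP.
have /eqP : (y1 - y2) * (y1 + y2) = 0.
  by have -> : (y1 - y2) * (y1 + y2) = y1 ^+ 2 - y2 ^+ 2; [ring | rewrite h1 h2 subrr].
by rewrite mulf_eq0 (negPf ne) orbF subr_eq0.
Qed.

Lemma pp_slopeP (p q : F * F) : oc (Some p) -> oc (Some q) ->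
  ~~ ((p.1 == q.1) && (p.2 == - q.2)) -> is_slope (slope E p q) p q.
Proof.
move=> hp hq npq; case: (eqVneq p.1 q.1) => [e|ne].
  have [epq ne] := pp_same_x hp hq e npq; subst q.
  split; rewrite /slope eqxx; first by rewrite !subrr mulr0.
  have h2 := pp_two_neq0; have hy : p.2 != 0.
    by apply: contraNneq ne => ->; rewrite addr0.
  by field; rewrite hy h2.
rewrite /is_slope /slope (negPf ne).
case: p q hp hq npq ne => [x1 y1] [x2 y2] /= /eqP h1 /eqP h2 _ ne.
have ne' : x2 - x1 != 0 by rewrite subr_eq0 eq_sym.
split; first by field.
apply: (mulfI ne'); have -> : (x2 - x1) * ((y2 - y1) / (x2 - x1) * (y1 + y2)) =
  y2 ^+ 2 - y1 ^+ 2 by field.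
by rewrite h1 h2; ring.
Qed.

Lemma pp_slope_uniq (p q : F * F) l m : oc (Some p) -> oc (Some q) ->
  ~~ ((p.1 == q.1) && (p.2 == - q.2)) ->
  is_slope l p q -> is_slope m p q -> l = m.
Proof.
move=> hp hq npq [l1 l2] [m1 m2]; case: (eqVneq p.1 q.1) => [e|ne].
  have [_ ne] := pp_same_x hp hq e npq.
  by apply: (mulIf ne); rewrite l2 m2.
have ne' : p.1 - q.1 != 0 by rewrite subr_eq0.
by apply: (mulIf ne'); rewrite -l1 -m1.
Qed.

Lemma pp_add_slope (p q : F * F) l : oc (Some p) -> oc (Some q) ->
  ~~ ((p.1 == q.1) && (p.2 == - q.2)) -> is_slope l p q ->
  Some p +' Some q = Some (chord l p q).
Proof.
move=> hp hq npq hl; rewrite /= (negPf npq).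
by rewrite (pp_slope_uniq hp hq npq (pp_slopeP hp hq npq) hl).
Qed.

Lemma pp_chord_on l (p q : F * F) : oc (Some p) -> is_slope l p q ->
  oc (Some (chord l p q)).
Proof.
case: p q => [x1 y1] [x2 y2] /= /eqP h1 [/= l1 l2]; apply/eqP.
have e2 : y2 = y1 - l * (x1 - x2) by rewrite -l1; ring.
have ea : a = l * (y1 + y2) - (x1 ^+ 2 + x1 * x2 + x2 ^+ 2) by rewrite l2; ring.
have eb : b = y1 ^+ 2 - x1 ^+ 3 - a * x1 by rewrite h1; ring.
by rewrite eb ea e2; ring.
Qed.

Lemma is_slopeC l (p q : F * F) : is_slope l p q -> is_slope l q p.
Proof.
move=> [l1 l2]; split; first by rewrite -opprB l1; ring.
by rewrite addrC l2; ring.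
Qed.

Lemma pp_chordC l (p q : F * F) : is_slope l p q -> chord l p q = chord l q p.
Proof.
case: p q => [x1 y1] [x2 y2] [/= l1 _].
have e2 : y2 = y1 - l * (x1 - x2) by rewrite -l1; ring.
by rewrite /chord /= e2; congr pair; ring.
Qed.

Lemma on_curve_opp P : oc P -> oc (~- P).
Proof. by case: P => [[x y]|] //=; rewrite sqrrN. Qed.

Lemma on_curve_add P Q : oc P -> oc Q -> oc (P +' Q).
Proof.
case: P Q => [p|] [q|] // hp hq; rewrite /=.
case: ifPn => // npq; exact: pp_chord_on hp (pp_slopeP hp hq npq).
Qed.

Lemma pp_oppP (p q : F * F) :
  reflect (Some p = ~- Some q) ((p.1 == q.1) && (p.2 == - q.2)).
Proof.
case: p q => [x1 y1] [x2 y2] /=; apply: (iffP andP).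
  by case=> /eqP -> /eqP ->.
by case=> -> ->; rewrite !eqxx.
Qed.

Lemma pp_oppK P : ~- ~- P = P.
Proof. by case: P => [[x y]|] //=; rewrite opprK. Qed.

Lemma pp_add0 P : None +' P = P. Proof. by []. Qed.
Lemma pp_addN P : ~- P +' P = None.
Proof. by case: P => [[x y]|] //=; rewrite !eqxx. Qed.

Lemma pp_addC P Q : oc P -> oc Q -> P +' Q = Q +' P.
Proof.
case: P Q => [p|] [q|] // hp hq.
case: (boolP ((p.1 == q.1) && (p.2 == - q.2))) => npq.
  have /andP[/eqP e1 /eqP e2] := npq.
  by rewrite /= npq e1 e2 opprK !eqxx.
have nqp : ~~ ((q.1 == p.1) && (q.2 == - p.2)).
  by apply: contra npq => /andP[/eqP -> /eqP ->]; rewrite opprK !eqxx.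
have hl := pp_slopeP hp hq npq.
by rewrite (pp_add_slope hp hq npq hl) (pp_add_slope hq hp nqp (is_slopeC hl)) (pp_chordC hl).
Qed.

Lemma pp_addNr P : oc P -> P +' ~- P = None.
Proof. by move=> hP; rewrite pp_addC ?on_curve_opp // pp_addN. Qed.

Lemma pp_oppD P Q : oc P -> oc Q -> ~- (P +' Q) = ~- P +' ~- Q.
Proof.
case: P Q => [p|] [q|] // hp hq; last by case: p {hp}.
have [epq|npq] := boolP ((p.1 == q.1) && (p.2 == - q.2)).
  rewrite /= epq; case/andP: epq; case: p q {hp hq} => [x1 y1] [x2 y2] /=.
  by move=> /eqP -> /eqP ->; rewrite !eqxx.
have [l1 l2] := pp_slopeP hp hq npq.
set l := slope E p q in l1 l2.
have hp' := on_curve_opp hp; have hq' := on_curve_opp hq.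
rewrite (pp_add_slope hp hq npq (conj l1 l2)).
case: p q l l1 l2 hp hq npq hp' hq' => [x1 y1] [x2 y2] l /= l1 l2 hp hq npq hp' hq'.
have npq' : ~~ ((x1 == x2) && (- y1 == - - y2)) by rewrite eqr_opp.
have hl : is_slope (- l) (x1, - y1) (x2, - y2).
  by split => /=; rewrite ?mulNr -?l1 -?l2; ring.
rewrite -[RHS]/(Some (x1, - y1) +' Some (x2, - y2)).
by rewrite (@pp_add_slope (x1, - y1) (x2, - y2) _ hp' hq' npq' hl) /chord /=; congr (Some (_, _)); ring.
Qed.

(* (P + Q) - Q = P *)
Lemma pp_addK P Q : oc P -> oc Q -> (P +' Q) +' ~- Q = P.
Proof.
case: Q => [q|]; last by case: P.
case: P => [p|] hp hq; last by rewrite pp_add0 pp_addNr.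
have [/pp_oppP ->|npq] := boolP ((p.1 == q.1) && (p.2 == - q.2)).
  by rewrite pp_addN.
have [l1 l2] := pp_slopeP hp hq npq.
set l := slope E p q in l1 l2.
have hpq := pp_chord_on hp (conj l1 l2).
have hq' := on_curve_opp hq.
rewrite (pp_add_slope hp hq npq (conj l1 l2)).
move: (ec_smooth E) (pp_two_neq0); rewrite /discriminant => sm h2.
case: p q l l1 l2 hp hq npq hpq hq' => [x1 y1] [x2 y2] l /= l1 l2 hp hq npq hpq hq'.
have e1 : y1 = y2 + l * (x1 - x2) by rewrite -l1; ring.
have ea : a = l * (y1 + y2) - (x1 ^+ 2 + x1 * x2 + x2 ^+ 2) by rewrite l2; ring.
have hl : is_slope (- l) (chord l (x1, y1) (x2, y2)) (x2, - y2).
  by split => /=; rewrite ?ea e1; ring.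
rewrite -[LHS]/(Some (chord l (x1, y1) (x2, y2)) +' Some (x2, - y2)).
rewrite (@pp_add_slope (chord l (x1, y1) (x2, y2)) (x2, - y2) _ hpq hq' _ hl) /=.
  by rewrite /chord /=; congr (Some (_, _)); ring.
apply/negP=> /andP[/eqP ex /eqP ey]; rewrite opprK in ey.
have y20 : y2 = 0.
  apply: (mulfI h2); rewrite mulr0; transitivity (y2 + y2); first by ring.
  by rewrite -{1}ey ex e1; ring.
have a0 : a = - 3%:R * x2 ^+ 2.
  have el : l ^+ 2 = x1 + x2 + x2 by rewrite -{2}ex; ring.
  rewrite ea e1 y20; transitivity
    (l ^+ 2 * (x1 - x2) - (x1 ^+ 2 + x1 * x2 + x2 ^+ 2)); first by ring.
  by rewrite el; ring.
move/eqP: hq; rewrite y20 a0 => hb.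
move/eqP: sm; apply.
have -> : b = 2%:R * x2 ^+ 3.
  by rewrite -[b](addrK (x2 ^+ 3 + - 3%:R * x2 ^+ 2 * x2)) [b + _]addrC -hb; ring.
by rewrite a0; ring.
Qed.

Lemma pp_assoc_calc (x1 x2 x3 l m y2 : F) :
  let y1 := y2 + l * (x1 - x2) in let y3 := y2 + m * (x3 - x2) in
  let x4 := l ^+ 2 - x1 - x2 in let y4 := l * (x1 - x4) - y1 in
  let x5 := m ^+ 2 - x2 - x3 in let y5 := m * (x2 - x5) - y2 in
  let l' := (y3 - y4) / (x3 - x4) in let m' := (y5 - y1) / (x5 - x1) in
  2%:R * (m - l) != 0 -> x3 - x4 != 0 -> x5 - x1 != 0 ->
  y2 = ((x3 - x1) * (x1 + x2 + x3) - m ^+ 2 * (x3 - x2) + l ^+ 2 * (x1 - x2))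
       / (2%:R * (m - l)) ->
  l' ^+ 2 - x4 - x3 = m' ^+ 2 - x1 - x5 /\
  l' * (x4 - (l' ^+ 2 - x4 - x3)) - y4 = m' * (x1 - (m' ^+ 2 - x1 - x5)) - y1.
Proof.
move=> y1 y3 x4 y4 x5 y5 l' m'.
rewrite mulf_eq0 negb_or => /andP[H2 H3].
rewrite /l' /m' /y5 /x5 /y4 /x4 /y3 /y1 => H4 H5 ->.
by split; field; rewrite H2 H3 H4 H5.
Qed.

Definition pp_xneq P Q := if (P, Q) is (Some p, Some q) then p.1 != q.1 else true.

Lemma pp_xneqP P Q : oc P -> oc Q -> P != Q -> P != ~- Q -> pp_xneq P Q.
Proof.
case: P Q => [p|] [q|] // hp hq npq /eqP npq'; rewrite /pp_xneq.
apply: contraNneq npq => e.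
have [|-> //] := pp_same_x hp hq e; exact/pp_oppP.
Qed.

Lemma pp_assoc_gen P Q R : oc P -> oc Q -> oc R ->
  P != ~- Q -> Q != ~- R -> pp_xneq (P +' Q) R -> pp_xneq P (Q +' R) ->
  (P +' Q) +' R = P +' (Q +' R).
Proof.
case: P Q R => [p|] [q|] [r|] // hp hq hr; rewrite ?pp_add0 //; last first.
  by case: (_ +' _) => [[]|].
move=> /eqP/pp_oppP npq /eqP/pp_oppP nqr.
have := pp_slopeP hp hq npq; have := pp_slopeP hq hr nqr.
move: (slope E p q) (slope E q r) => l m hm hl.
rewrite (pp_add_slope hp hq npq hl) (pp_add_slope hq hr nqr hm); rewrite {1 2}/pp_xneq => n4 n5.
have [epr|npr] := eqVneq p r.
  subst r; have hpq : oc (Some p +' Some q) by apply: on_curve_add.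
  rewrite -(pp_add_slope hp hq npq hl) -(pp_add_slope hq hr nqr hm).
  by rewrite (pp_addC hpq hp) (pp_addC hp hq).
have [l1 l2] := hl; have [m1 m2] := hm.
have h4 := pp_chord_on hp hl; have h5 := pp_chord_on hq hm.
have D4 : ~~ (((chord l p q).1 == r.1) && ((chord l p q).2 == - r.2)).
  by rewrite negb_and n4.
have D5 : ~~ ((p.1 == (chord m q r).1) && (p.2 == - (chord m q r).2)).
  by rewrite negb_and n5.
rewrite /= (negPf D4) (negPf D5) /slope (negPf n4) (negPf n5).
move: (pp_two_neq0) => h2; congr Some.
case: p q r l1 l2 m1 m2 {hl hm h4 h5 D4 D5 npq nqr} n4 n5 npr hp hq hr
  => [x1 y1] [x2 y2] [x3 y3] /= l1 l2 m1 m2 n4 n5 npr _ _ _.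
have e1 : y1 = y2 + l * (x1 - x2) by rewrite -l1; ring.
have e3 : y3 = y2 + m * (x3 - x2).
  by rewrite -[x3 - x2]opprB mulrN -m1; ring.
have rel : 2%:R * (m - l) * y2 =
  (x3 - x1) * (x1 + x2 + x3) - m ^+ 2 * (x3 - x2) + l ^+ 2 * (x1 - x2).
  transitivity (m * (y2 + y3) - m ^+ 2 * (x3 - x2)
                - (l * (y1 + y2) - l ^+ 2 * (x1 - x2))).
    by rewrite e1 e3; ring.
  by rewrite m2 l2; ring.
have nml : m - l != 0.
  rewrite subr_eq0; apply: contraNneq npr => eml; subst m.
  have /eqP : (x3 - x1) * (x1 + x2 + x3 - l ^+ 2) = 0.
    transitivity (2%:R * (l - l) * y2); last by rewrite subrr mulr0 mul0r.
    by rewrite rel; ring.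
  rewrite mulf_eq0 => /orP[|/eqP e]; last first.
    by case/eqP: n4; rewrite -[RHS](subr0) -e; ring.
  by rewrite subr_eq0 => /eqP e; subst x3; rewrite e1 e3.
have nd : 2%:R * (m - l) != 0 by rewrite mulf_neq0.
have e2 : y2 = ((x3 - x1) * (x1 + x2 + x3) - m ^+ 2 * (x3 - x2)
  + l ^+ 2 * (x1 - x2)) / (2%:R * (m - l)) by rewrite -rel mulrAC mulfV ?mul1r.
have N4 : x3 - (l ^+ 2 - x1 - x2) != 0 by rewrite subr_eq0 eq_sym.
have N5 : (m ^+ 2 - x2 - x3) - x1 != 0 by rewrite subr_eq0 eq_sym.
have [c1 c2] := pp_assoc_calc nd N4 N5 e2.
rewrite /chord /= e1 e3; congr pair; [exact: c1|exact: c2].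
Qed.

Lemma pp_add_cancel P Q R : oc P -> oc Q -> oc R -> P +' Q = P +' R -> Q = R.
Proof.
move=> hP hQ hR e.
by rewrite -(pp_addK hQ hP) -(pp_addK hR hP) (pp_addC hQ hP) (pp_addC hR hP) e.
Qed.

Lemma pp_add_idl P Q : oc P -> oc Q -> P +' Q = P -> Q = None.
Proof.
move=> hP hQ e; apply: (@pp_add_cancel P) => //; rewrite e.
by case: (P).
Qed.

Lemma pp_addr0 P : P +' None = P. Proof. by case: P. Qed.

Lemma pp_addKl P Q : oc P -> oc Q -> ~- P +' (P +' Q) = Q.
Proof.
move=> hP hQ; rewrite (pp_addC hP hQ) pp_addC ?pp_addK //; first exact: on_curve_opp.
exact: on_curve_add.
Qed.

Lemma pp_assoc_sym P Q R : oc P -> oc Q -> oc R ->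
  (R +' Q) +' P = R +' (Q +' P) -> (P +' Q) +' R = P +' (Q +' R).
Proof.
move=> hP hQ hR e.
have hPQ := on_curve_add hP hQ; have hQR := on_curve_add hQ hR.
by rewrite (pp_addC hPQ hR) (pp_addC hP hQ) (pp_addC hP hQR) (pp_addC hQ hR) e.
Qed.

Lemma pp_assoc_opp P Q R : oc P -> oc Q -> oc R ->
  P +' Q = ~- R -> (P +' Q) +' R = P +' (Q +' R).
Proof.
move=> hP hQ hR e; rewrite e pp_addN -(pp_oppK R) -e (pp_addC hP hQ) pp_oppD //.
by rewrite -{1}(pp_oppK Q) pp_addKl ?on_curve_opp // pp_addNr.
Qed.

Lemma pp_assoc_generic P Q R : oc P -> oc Q -> oc R ->
  P +' Q != R -> P != Q +' R -> (P +' Q) +' R = P +' (Q +' R).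
Proof.
move=> hP hQ hR n1 n2.
have hPQ := on_curve_add hP hQ; have hQR := on_curve_add hQ hR.
have [e|n3] := eqVneq P (~- Q); first by rewrite e pp_addN pp_add0 pp_addKl.
have [e|n4] := eqVneq Q (~- R).
  have hQ' : oc (~- R) by rewrite -e.
  by rewrite e pp_addN pp_addr0 -{2}(pp_oppK R) pp_addK.
have [|n5] := eqVneq (P +' Q) (~- R); first exact: pp_assoc_opp.
have [e|n6] := eqVneq P (~- (Q +' R)).
  by apply: pp_assoc_sym => //; apply: pp_assoc_opp; rewrite // (pp_addC hR hQ) e pp_oppK.
by apply: pp_assoc_gen; rewrite ?pp_xneqP.
Qed.

Lemma pp_assoc_dup0 P R : oc P -> oc R -> P +' P != R ->
  (P +' P) +' R = P +' (P +' R).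
Proof.
move=> hP hR n.
have [/esym e|n1] := eqVneq P (P +' R).
  by rewrite (pp_add_idl hP hR e) !pp_addr0.
exact: pp_assoc_generic.
Qed.

Lemma pp_assoc_dup P R : oc P -> oc R -> (P +' P) +' R = P +' (P +' R).
Proof.
move=> hP hR; have hN := on_curve_opp hP.
have [e|n] := eqVneq (P +' P) R; last exact: pp_assoc_dup0.
have eD : R +' ~- P = P by rewrite -e pp_addK.
have hRR := on_curve_add hR hR; have hPR := on_curve_add hP hR.
rewrite e; have [e'|n] := eqVneq (R +' R) (~- P).
  have -> : P +' R = ~- R by rewrite -{2}(pp_addK hR hR) e' pp_oppD ?on_curve_opp // !pp_oppK.
  by rewrite e' -{1}eD pp_oppD // pp_oppK pp_addC // on_curve_opp.
have := pp_assoc_dup0 hR hN n; rewrite eD => {}e.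
rewrite -(pp_addK hRR hN) pp_oppK e (pp_addC hR hP) pp_addC //; exact: on_curve_add.
Qed.

Lemma pp_addA P Q R : oc P -> oc Q -> oc R -> (P +' Q) +' R = P +' (Q +' R).
Proof.
have aux P1 Q1 : oc P1 -> oc Q1 ->
    (P1 +' Q1) +' (P1 +' Q1) = P1 +' (Q1 +' (P1 +' Q1)).
  move=> hP hQ; have hD := on_curve_add hP hQ; have hN := on_curve_opp hP.
  have eQ : (P1 +' Q1) +' ~- P1 = Q1 by rewrite (pp_addC hP hQ) pp_addK.
  have := pp_assoc_dup hD hN; rewrite eQ => e.
  rewrite -(pp_addK (on_curve_add hD hD) hN) pp_oppK e (pp_addC hD hQ) pp_addC //.
  exact: on_curve_add.
move=> hP hQ hR.
have [<-|n1] := eqVneq (P +' Q) R; first exact: aux.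
have [e|n2] := eqVneq P (Q +' R); last exact: pp_assoc_generic.
by apply: pp_assoc_sym => //; rewrite e (pp_addC hQ hR); apply: aux.
Qed.

End GroupLaw.

Record point (F : fieldType) (E : ellipticCurve F) := Point {
  pval : option (F * F);
  pvalP : on_curve E pval
}.

HB.instance Definition _ F E := [isSub for @pval F E].
HB.instance Definition _ (F : fieldType) (E : ellipticCurve F) :=
  [Choice of point E by <:].

Section PointGroup.
Variables (F : fieldType) (E : ellipticCurve F).
Implicit Types P Q R : point E.

Definition point0 : point E := @Point F E None isT.
Definition point_opp P : point E := Point (on_curve_opp (pvalP P)).
Definition point_add P Q : point E :=
  Point (on_curve_add (pvalP P) (pvalP Q)).

Fact point_addA : associative point_add.
Proof.
by move=> P Q R; apply/val_inj => /=; rewrite pp_addA //; apply: pvalP.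
Qed.

Fact point_addC : commutative point_add.
Proof. by move=> P Q; apply/val_inj; apply: pp_addC; apply: pvalP. Qed.

Fact point_add0 : left_id point0 point_add.
Proof. by move=> P; apply/val_inj. Qed.

Fact point_addN : left_inverse point0 point_opp point_add.
Proof. by move=> P; apply/val_inj; apply: pp_addN. Qed.

End PointGroup.

HB.instance Definition _ (F : fieldType) (E : ellipticCurve F) :=
  GRing.isZmodule.Build (point E)
    (@point_addA F E) (@point_addC F E) (@point_add0 F E) (@point_addN F E).

Definition Z_independent (V : zmodType) (n : nat) (v : 'I_n -> V) : Prop :=
  forall m : 'I_n -> int, \sum_(i < n) v i *~ m i = 0 -> forall i, m i = 0.

(* The rank of an abelian group is the supremum of the sizes of its
   Z-linearly independent families. *)
Definition rank_at_least (n : nat) (V : zmodType) : Prop :=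
  exists v : 'I_n -> V, Z_independent v.

(* The literals below are binary integers; the key Z is taken by int, whose
   literals are unary. *)
Local Delimit Scope Z_scope with Zbin.

Definition polyS : {poly Z} :=
  307516108335972163537936%Zbin *: 'X^8 +
  10476571005172375234427296%Zbin *: 'X^7 +
  234256046667228607566274912%Zbin *: 'X^6 +
  2020678721371875903158954848%Zbin *: 'X^5 +
  8789387383568632081365832240%Zbin *: 'X^4 +
  21430123310022469548285709072%Zbin *: 'X^3 +
  28607402618712438778345257832%Zbin *: 'X^2 +
  17860826619093915900857289304%Zbin *: 'X +
  4201305425690184127251888481%Zbin%:P.

Definition polyT : {poly Z} :=
  1050290276365892761266194577222156800%Zbin *: 'X^12 +
  67802587761728815952013525763236564480%Zbin *: 'X^11 +
  2392486076703808362288120169049836903680%Zbin *: 'X^10 +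
  38126035250980128714796491999580538771200%Zbin *: 'X^9 +
  372202978476351718721663756748866085220800%Zbin *: 'X^8 +
  2373760737463050257069464720014664373086080%Zbin *: 'X^7 +
  9904246958414858348647761354992989326760320%Zbin *: 'X^6 +
  26905633537996991160744810870319331164617600%Zbin *: 'X^5 +
  47243082583908684509409509915652973906060800%Zbin *: 'X^4 +
  52862444598312784274784438443066814490530880%Zbin *: 'X^3 +
  36435013603665838306995466090052055171475872%Zbin *: 'X^2 +
  13865015501478235534002649882546248548532768%Zbin *: 'X +
  2193201312876924214657300134273061462776968%Zbin%:P.

Definition evalZ (p : {poly Z}) (t : rat) : rat :=
  (map_poly (fun c => (int_of_Z c)%:~R) p).[t].

Definition fiber (t : rat) : weierstrass rat :=
  Weierstrass (- 27%:R * evalZ polyS t) (27%:R / 4%:R * evalZ polyT t).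

(* Main.v *)
Require Import Defs.
From Stdlib Require Import ZArith Zpow_facts Lia.
From HB Require Import structures.
From mathcomp Require Import all_boot all_order all_algebra finfield ring zify.
From mathcomp.zify Require Import ssrZ.

(* The fiber over t = -9529/5471 is isomorphic to Elkies's curve of rank at least
   28, whose 28 published generators are scaled onto it.  Independence is proved
   by a 2-descent.  Write the curve as Y^2 = f(X) with f an integral monic cubic
   without rational roots, so that there is no rational 2-torsion and P |-> X(P) - X
   is a homomorphism from the group of rational points to the units of Q[X]/(f)
   modulo squares.  If the odd part of a relation between the generators were
   nonempty, a product of distinct X(P_i) - X would be a square modulo f over Q.
   For a prime p modulo which f has three distinct roots, the denominator of a
   square root can be freed of p, so the product evaluated at each root is a square
   modulo p.  The Legendre symbols at 28 pairs (prime, root) form an invertible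
   matrix over F_2, so every coefficient of a relation is even, and infinite
   descent on the coefficients concludes. *)

Set Implicit Arguments.
Unset Strict Implicit.
Unset Printing Implicit Defensive.

Import GRing.Theory Num.Theory.
Local Open Scope ring_scope.
Local Delimit Scope Z_scope with Zbin.

(** * Infinite descent on the coefficients of a relation *)

(** Without 2-torsion, a relation with even coefficients can be halved, which lowers the sum of
    their absolute values unless all are zero. *)
Lemma Z_independent_of_even (V : zmodType) (n : nat) (v : 'I_n -> V) :
  (forall x : V, x *+ 2 = 0 -> x = 0) ->
  (forall m : 'I_n -> int, \sum_(i < n) v i *~ m i = 0 ->
     forall i, (2 %| m i)%Z) ->
  Z_independent v.
Proof.
move=> tf ev m; have [k] := ubnP (\sum_(i < n) `|m i|)%N.
elim: k m => // k IH m lek m0.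
pose m' i := (m i %/ 2)%Z.
have em i : m i = m' i * 2 by rewrite /m' divzK ?ev.
have m'0 : \sum_(i < n) v i *~ m' i = 0.
  apply: tf; rewrite -[RHS]m0 -sumrMnl; apply: eq_bigr => i _.
  by rewrite [in RHS]em mulrzA.
have half i : (`|m i| = `|m' i| + `|m' i|)%N.
  by rewrite [in LHS]em abszM muln2 addnn.
have [z nz|nz] := pickP (fun i => m i != 0); last first.
  by move=> i; apply/eqP/negbFE; rewrite nz.
move=> j; rewrite em (IH m') ?mul0r //.
rewrite -ltnS; apply: leq_trans lek; rewrite ltnS.
rewrite (eq_bigr _ (fun i _ => half i)) big_split /= -addn1 leq_add2l.
rewrite (bigD1 z) //= (leq_trans _ (leq_addr _ _)) // absz_gt0.
by apply: contra nz => /eqP e; rewrite em e mul0r.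
Qed.

(** * Squares modulo a polynomial *)

Section SquareClasses.
Variables (F : fieldType) (f : {poly F}).
Implicit Types u v : {poly F}.

Definition square_mod u := exists g, f %| u - g ^+ 2.

Lemma square_mod_sqr u : square_mod (u ^+ 2).
Proof. by exists u; rewrite subrr dvdp0. Qed.

Lemma square_modM u v : square_mod u -> square_mod v -> square_mod (u * v).
Proof.
move=> [g hg] [h hh]; exists (g * h).
have -> : u * v - (g * h) ^+ 2 = (u - g ^+ 2) * v + g ^+ 2 * (v - h ^+ 2) by ring.
by apply: dvdp_add; [apply: dvdp_mulr | apply: dvdp_mull].
Qed.

(** By Bezout, [v] has an inverse [b] modulo [f]; if [g] is a root of [v ^+ 2 * u], then [b * g] is
    one of [u]. *)
Lemma square_mod_cancel u v : coprimep f v -> square_mod (v ^+ 2 * u) -> square_mod u.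
Proof.
move=> /Bezout_eq1_coprimepP [[a b] /= e] [g hg]; exists (b * g).
have -> : u - (b * g) ^+ 2 =
  b ^+ 2 * (v ^+ 2 * u - g ^+ 2) + a * (1 + b * v) * u * f.
  have af : a * f = 1 - b * v by rewrite -e; ring.
  have -> : a * (1 + b * v) * u * f = a * f * (1 + b * v) * u by ring.
  by rewrite af; ring.
by apply: dvdp_add; apply: dvdp_mull.
Qed.

End SquareClasses.

(** * The 2-descent homomorphism *)

Section TwoDescent.
Variables (F : fieldType) (E : ellipticCurve F) (w : F).
Implicit Types P Q R : point E.

(* The cubic satisfied by w^2 x, which is integral for suitable w. *)
Definition descent_cubic : {poly F} :=
  'X ^+ 3 + (w ^+ 4 * wa E) *: 'X + (w ^+ 6 * wb E)%:P.

Definition descent P : {poly F} :=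
  if pval P is Some p then (w ^+ 2 * p.1)%:P - 'X else 1.

(** If L is the line through P and Q, then f - L^2 is monic with the abscissas of P, Q and P + Q as
    roots. So the product of the three factors x - X is L^2 - f, a square modulo f. *)
Lemma descent_add P Q : square_mod descent_cubic (descent P * descent Q * descent (P + Q)).
Proof.
rewrite /descent; have -> : pval (P + Q) = pp_add E (pval P) (pval Q) by [].
case: P Q => [[p|] hp] [[q|] hq]; rewrite /= ?mulr1 ?mul1r -?expr2;
  try exact: square_mod_sqr; last first.
  by exists 1; rewrite expr1n subrr dvdp0.
case: ifPn => npq.
  by case/andP: npq => /eqP -> _; rewrite mulr1 -expr2; apply: square_mod_sqr.
have [] := pp_slopeP hp hq npq; move: (slope E p q) => l.
case: p q hp hq npq => [x1 y1] [x2 y2] /= /eqP h1 /eqP h2 npq l1 l2.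
(* The line through P and Q in the scaled coordinates (w^2 x, w^3 y), where its slope is w l. *)
exists ((w ^+ 3 * y1)%:P + (w * l) *: ('X - (w ^+ 2 * x1)%:P)).
have e2 : y2 = y1 - l * (x1 - x2) by rewrite -l1; ring.
have ea : wa E = l * (y1 + y2) - (x1 ^+ 2 + x1 * x2 + x2 ^+ 2) by rewrite l2; ring.
have eb : wb E = y1 ^+ 2 - x1 ^+ 3 - wa E * x1 by rewrite h1; ring.
have -> : ((w ^+ 2 * x1)%:P - 'X) * ((w ^+ 2 * x2)%:P - 'X) *
  ((w ^+ 2 * (l ^+ 2 - x1 - x2))%:P - 'X) -
  ((w ^+ 3 * y1)%:P + (w * l) *: ('X - (w ^+ 2 * x1)%:P)) ^+ 2 = - descent_cubic.
  rewrite /descent_cubic eb ea e2 -!mul_polyC !(polyCD, polyCM, polyCN, polyC_exp); ring.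
by rewrite dvdpNr.
Qed.

Hypothesis no_root : forall x, ~~ root descent_cubic x.

Lemma coprime_descent P : coprimep descent_cubic (descent P).
Proof.
rewrite /descent; case: (pval P) => [p|]; last exact: coprimep1.
by rewrite -opprB -scaleN1r coprimepZr ?oppr_eq0 ?oner_eq0 ?coprimep_XsubC.
Qed.

Lemma no_2_torsion P : P *+ 2 = 0 -> P = 0.
Proof.
rewrite mulr2n => h; have e : P = - P by apply/eqP; rewrite -addr_eq0 h.
case: P {h} e => [[[x y]|] hP] e; last exact/val_inj.
have {e} [ey] : Some (x, y) = Some (x, - y) := congr1 (@pval F E) e.
have y0 : y = 0.
  apply: (mulfI (pp_two_neq0 E)); rewrite mulr0; transitivity (y + y); first by ring.
  by rewrite {1}ey addNr.
case/negP: (no_root (w ^+ 2 * x)); apply/rootP.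
move: hP => /eqP; rewrite y0 => {}hP.
rewrite /descent_cubic !(hornerD, hornerZ, hornerXn, hornerX, hornerC).
transitivity (w ^+ 6 * (x ^+ 3 + wa E * x + wb E)); first by ring.
by rewrite -hP expr0n /= mulr0.
Qed.

Lemma descent_sum (I : Type) (s : seq I) (v : I -> point E) :
  square_mod descent_cubic (descent (\sum_(i <- s) v i) * \prod_(i <- s) descent (v i)).
Proof.
elim: s => [|i s IH].
  by rewrite !big_nil mulr1; exists 1; rewrite /descent expr1n subrr dvdp0.
rewrite !big_cons; set Q := \sum_(j <- s) v j in IH *.
apply: (square_mod_cancel (coprime_descent Q)).
have := square_modM (descent_add (v i) Q) IH.
by congr square_mod; ring.
Qed.

Lemma descent_double P : square_mod descent_cubic (descent (P + P)).
Proof.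
apply: (square_mod_cancel (coprime_descent P)).
by have := descent_add P P; rewrite expr2.
Qed.

(** Moving the even parts of the relation to the other side shows that the points with odd
    coefficients sum to a double, whose class is trivial. *)
Lemma descent_odd_part n (v : 'I_n -> point E) (m : 'I_n -> int) :
  \sum_(i < n) v i *~ m i = 0 ->
  square_mod descent_cubic (\prod_(i < n | ~~ (2 %| m i)%Z) descent (v i)).
Proof.
move=> m0; pose R := \sum_(i < n) v i *~ (- (m i %/ 2)%Z).
have e : \sum_(i < n | ~~ (2 %| m i)%Z) v i = R + R.
  apply/eqP; rewrite -subr_eq0 -[X in _ == X]m0 big_mkcond opprD /R -!sumrN.
  rewrite -!big_split /=; apply/eqP/eq_bigr => i _.
  rewrite !mulrNz !opprK -mulrzDr [in RHS](divz_eq (m i) 2).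
  have := modz_ge0 (m i) (isT : 2 != 0 :> int); have := ltz_mod (m i) (isT : 2 != 0 :> int).
  rewrite (sameP dvdz_mod0P eqP); move: (m i %/ 2)%Z (m i %% 2)%Z => q.
  case=> [[|[|r]]|r] //= _ _.
    by rewrite add0r; congr (_ *~ _); ring.
  by rewrite -[X in X + _]mulr1z -mulrzDr; congr (_ *~ _); ring.
rewrite -big_filter; set s := filter _ _.
apply: (square_mod_cancel (coprime_descent (R + R))).
have := square_modM (descent_double R) (descent_sum s v).
by rewrite big_filter e; congr square_mod; ring.
Qed.

End TwoDescent.

(** * Reduction of squares modulo a prime *)

(* Write the square root as G / D. If p divides D, then G^2 vanishes modulo p at
   all roots of f, hence so does G, whose degree is too small unless G = 0 modulo p;
   so p cancels from G / D. *)
Lemma square_mod_reduction (f u : {poly int}) (p : nat) (s : seq 'F_p) :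
  f \is monic -> prime p ->
  uniq s -> all (root (map_poly intr f)) s -> (size f <= (size s).+1)%N ->
  square_mod (map_poly intr f : {poly rat}) (map_poly intr u) ->
  {in s, forall r, exists z, (map_poly intr u).[r] = z ^+ 2}.
Proof.
move=> monf pp us fs szs [g fg] r rs.
have f0 : map_poly intr f != 0 :> {poly rat}.
  by rewrite -size_poly_gt0 size_map_inj_poly ?size_poly_gt0 ?monic_neq0 //; apply: intr_inj.
(* Reducing the root modulo f bounds its degree; then denominators are cleared. *)
have [G [D [D0 szG dvG]]] : exists (G : {poly int}) (D : int),
    [/\ D != 0, (size G < size f)%N & f %| (D ^+ 2 *: u - G ^+ 2)].
  have [G [D D0 e]] := rat_poly_scale (g %% map_poly intr f).
  exists G, D; split=> //.
    have := ltn_modp g (map_poly intr f); rewrite f0 e size_scale ?invr_eq0 ?intr_eq0 //.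
    by rewrite !size_map_inj_poly //; apply: intr_inj.
  rewrite -dvdp_rat_int rmorphB rmorphXn /= map_polyZ /=.
  have eG : map_poly intr G = D%:~R *: (g %% map_poly intr f).
    by rewrite e scalerA mulfV ?scale1r // intr_eq0.
  rewrite eG rmorphXn exprZn -scalerBr dvdpZr ?expf_neq0 ?intr_eq0 //.
  move: fg; rewrite {1}(divp_eq g (map_poly intr f)).
  set q := g %/ _; set t := g %% _.
  have -> : map_poly intr u - (q * map_poly intr f + t) ^+ 2
    = map_poly intr u - t ^+ 2 - (q * (q * map_poly intr f + t + t)) * map_poly intr f by ring.
  by rewrite dvdp_subl // dvdp_mull.
have ch := pchar_Fp pp.
have [k] := ubnP `|D|%N; elim: k D G D0 szG dvG => // k IH D G D0 szG dvG leD.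
have red t : t \in s -> (D%:~R ^+ 2 * (map_poly intr u).[t] = (map_poly intr G).[t] ^+ 2 :> 'F_p).
  (* Since [f] is monic, the quotient is integral, so the identity can be reduced modulo p and
     evaluated at a root. *)
  move=> ts; have [h] := dvdpP_int dvG; rewrite zprimitive_monic //.
  move=> /(congr1 (fun a => (map_poly (intr : int -> 'F_p) a).[t])).
  rewrite rmorphB rmorphXn rmorphM /= map_polyZ /= !hornerE (rootP (allP fs t ts)) mul0r.
  by rewrite rmorphXn => /eqP; rewrite subr_eq0 => /eqP.
have [pD|npD] := boolP (p %| D)%Z; last first.
  have D0' : D%:~R != 0 :> 'F_p by rewrite -(dvdz_pcharf ch).
  exists ((map_poly intr G).[r] / D%:~R); rewrite expr_div_n -red //.
  by rewrite mulrC mulKf ?expf_neq0.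
have G0 : map_poly intr G = 0 :> {poly 'F_p}.
  apply: (@roots_geq_poly_eq0 _ _ s) => //.
    apply/allP => t ts; have := red t ts.
    by rewrite (dvdz_pcharf ch) in pD; rewrite (eqP pD) expr0n mul0r => /esym/eqP; rewrite expf_eq0.
  by rewrite -ltnS (leq_trans _ szs) // (leq_ltn_trans (size_poly _ _)).
pose G' := map_poly (fun c => (c %/ p)%Z) G.
have eG : G = p%:Z *: G'.
  apply/polyP => i; rewrite coefZ coef_map_id0 ?div0z // mulrC divzK //.
  by rewrite (dvdz_pcharf ch) -coef_map G0 coef0.
have p0 : p%:Z != 0 by rewrite eqz_nat -lt0n prime_gt0.
have eD : D = p%:Z * (D %/ p)%Z by rewrite mulrC divzK.
apply: (IH (D %/ p)%Z G').
- by apply: contraNneq D0 => e; rewrite eD e mulr0.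
- by apply: leq_ltn_trans szG; rewrite size_poly.
- rewrite -dvdp_rat_int; move: dvG; rewrite -dvdp_rat_int {1}eD eG exprZn exprMn -scalerA -scalerBr.
  by rewrite map_polyZ /= dvdpZr // intr_eq0 expf_neq0.
- apply: leq_trans (leD : `|D| <= k)%N.
  rewrite [X in (_ < `|X|)%N]eD abszM absz_nat ltn_Pmull ?prime_gt1 //.
  by rewrite absz_gt0; apply: contraNneq D0 => e; rewrite eD e mulr0.
Qed.

(** Raising to the power n = (p - 1)/2 turns the product into a sign, and a nonzero square into 1 by
    Fermat. The case z = 0 is excluded because a sign is not 0. *)
Lemma euler_prod (p n : nat) (I : finType) (P : pred I) (c : I -> 'F_p) (b : I -> bool) (z : 'F_p) :
  prime p -> p = n.*2.+1 -> (forall i, c i ^+ n = (-1) ^+ b i) ->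
  \prod_(i | P i) c i = z ^+ 2 -> ~~ \big[addb/false]_(i | P i) b i.
Proof.
move=> pp e cb /(congr1 (fun x => x ^+ n)).
rewrite -exprM mul2n -prodrXl (eq_bigr _ (fun i _ => cb i)).
have sgn : \prod_(i | P i) (-1) ^+ b i = (-1) ^+ (\big[addb/false]_(i | P i) b i) :> 'F_p.
  apply: (big_ind2 (fun (x : 'F_p) (y : bool) => x = (-1) ^+ y)) => // _ x _ y -> ->.
  by rewrite signr_addb.
have n0 : (0 < n)%N by move: pp; rewrite e; case: (n).
have zn : z != 0 -> z ^+ n.*2 = 1.
  move=> z0; apply: (mulfI z0); rewrite -exprS -e mulr1.
  by have := expf_card z; rewrite card_Fp.
have p2 : 2%:R != 0 :> 'F_p.
  by rewrite -(dvdn_pcharf (pchar_Fp pp)) gtnNdvd // e ltnS -muln2 leq_pmull.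
rewrite sgn; case: (\big[addb/false]_(i | P i) b i) => //.
have [->|z0] := eqVneq z 0.
  rewrite expr0n -leqn0 leqNgt double_gt0 n0 expr1.
  by move=> /eqP; rewrite oppr_eq0 oner_eq0.
rewrite zn // expr1 => /eqP; rewrite eq_sym -addr_eq0.
by rewrite (negPf p2).
Qed.

(** * Computation with binary integers *)

(** Binary integers make the numerical checks feasible; this morphism carries their outcome into
    [rat] and ['F_p]. *)
Definition ofZ (R : nzRingType) : Z -> R := intr \o int_of_Z.
HB.instance Definition _ (R : nzRingType) := GRing.RMorphism.on (@ofZ R).

Lemma ofZ_nat (R : nzRingType) n : ofZ R (Z.of_nat n) = n%:R.
Proof. by rewrite /ofZ /= -[Z.of_nat n]/(Z_of_int n) Z_of_intK. Qed.

Lemma ofZ_pow (R : nzRingType) z n : ofZ R (Z.pow z (Z.of_nat n)) = ofZ R z ^+ n.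
Proof.
elim: n => [|n IH]; first exact: rmorph1.
by rewrite Nat2Z.inj_succ Z.pow_succ_r ?exprS -?IH -?rmorphM //; apply: Zle_0_nat.
Qed.

Lemma ofZ_eq0 (R : numDomainType) z : (ofZ R z == 0) = (z == 0).
Proof. by rewrite /ofZ /= intr_eq0 -(inj_eq (can_inj int_of_ZK)). Qed.

Lemma ofZ_Fp_mod p z : prime p -> ofZ 'F_p (Z.modulo z (Z.of_nat p)) = ofZ 'F_p z.
Proof.
move=> pp; have p0 := prime_gt0 pp.
have e : z = Z.of_nat p * Z.div z (Z.of_nat p) + Z.modulo z (Z.of_nat p).
  by apply: Z.div_mod; lia.
by rewrite [in RHS]e rmorphD rmorphM /= ofZ_nat pchar_Fp_0 // mul0r add0r.
Qed.

Lemma ofZ_Fp_eq0 p z : prime p -> (ofZ 'F_p z == 0) = Z.eqb (Z.modulo z (Z.of_nat p)) Z0.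
Proof.
move=> pp; have p0 : Z.lt Z0 (Z.of_nat p) by have := prime_gt0 pp; lia.
rewrite -ofZ_Fp_mod //; have [] := Z.mod_pos_bound z (Z.of_nat p) p0.
move: (Z.modulo z _) => y y0 yp; rewrite -(Z2Nat.id y) // ofZ_nat.
rewrite -(dvdn_pcharf (pchar_Fp pp)).
apply/idP/(Z.eqb_spec _ Z0); last by rewrite Z2Nat.id // => ->.
have [->|y1 /dvdn_leq] := posnP (Z.to_nat y); first by [].
by move=> /(_ y1); lia.
Qed.

Definition cubicZ (A B : Z) : {poly int} := 'X^3 + int_of_Z A *: 'X + (int_of_Z B)%:P.

Lemma cubicZ_size_monic A B : size (cubicZ A B) = 4%N /\ cubicZ A B \is monic.
Proof.
have lt : (size (int_of_Z A *: 'X + (int_of_Z B)%:P)%R < size ('X^3 : {poly int})%R)%N.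
  rewrite size_polyXn (leq_ltn_trans (size_polyD _ _)) // gtn_max.
  by rewrite size_polyC (leq_ltn_trans (size_scale_leq _ _)) ?size_polyX //; case: eqP.
rewrite /cubicZ -addrA size_polyDl // size_polyXn; split=> //.
by rewrite monicE lead_coefDl // lead_coefXn.
Qed.

Definition cubic_val (A B r : Z) : Z := (r * r * r + A * r + B)%Zbin.

Lemma horner_cubicZ (R : comNzRingType) A B (x : Z) :
  (map_poly intr (cubicZ A B)).[ofZ R x] = ofZ R (cubic_val A B x).
Proof.
have -> : cubic_val A B x = x * x * x + A * x + B by [].
rewrite /cubicZ !rmorphD /= map_polyXn map_polyZ /= map_polyX map_polyC /=.
rewrite !(hornerD, hornerZ, hornerXn, hornerX, hornerC) !rmorphM.
by rewrite !exprS expr0 mulr1 mulrA.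
Qed.

Definition no_root_mod (A B : Z) (p : nat) : bool :=
  all (fun r => ~~ (cubic_val A B (Z.of_nat r) mod Z.of_nat p =? 0)%Zbin) (iota 0 p).

(** For a root n/d in lowest terms, clear denominators. If p divides d, it divides n too, against
    coprimality; otherwise n/d reduces to a root modulo p. *)
Lemma cubicZ_no_rat_root p A B : prime p -> no_root_mod A B p ->
  forall x : rat, ~~ root (map_poly intr (cubicZ A B)) x.
Proof.
move=> pp /allP nr x; apply/negP => /rootP.
rewrite -{1}(divq_num_den x); set n := numq x; set d := denq x.
have d0 : d%:~R != 0 :> rat by rewrite intr_eq0 denq_neq0.
rewrite /cubicZ !rmorphD /= map_polyXn map_polyZ /= map_polyX map_polyC /=.
rewrite !(hornerD, hornerZ, hornerXn, hornerX, hornerC) => h.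
have {h} e : n ^+ 3 + int_of_Z A * n * d ^+ 2 + int_of_Z B * d ^+ 3 = 0.
  apply/eqP; rewrite -(intr_eq0 rat) !(rmorphD, rmorphM, rmorphXn) /=; apply/eqP.
  transitivity (d%:~R ^+ 3 * ((n%:~R / d%:~R) ^+ 3 +
    (int_of_Z A)%:~R * (n%:~R / d%:~R) + (int_of_Z B)%:~R) : rat); first by field.
  by rewrite h mulr0.
have /eqP := congr1 (intr : int -> 'F_p) e.
rewrite !(rmorphD, rmorphM, rmorphXn) /= => /eqP {}e.
have ch := pchar_Fp pp.
have [dp|dp] := eqVneq (d%:~R : 'F_p) 0.
  move: e; rewrite dp !expr0n !mulr0 !addr0 => /eqP; rewrite expf_eq0 /= => np.
  have := coprime_num_den x; rewrite /coprime => /eqP cop.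
  have : (p %| gcdn `|n| `|d|)%N.
    have dvdE z : (p %| `|z|)%N = (z%:~R == 0 :> 'F_p).
      by rewrite -(dvdz_pcharf ch) dvdzE.
    by rewrite dvdn_gcd !dvdE np dp eqxx.
  by rewrite cop dvdn1 => /eqP p1; rewrite p1 in pp.
pose t : 'F_p := n%:~R / d%:~R.
have et : ofZ 'F_p (Z.of_nat t) = t by rewrite ofZ_nat natr_Zp.
have tp : (t < p)%N by rewrite -{2}(Fp_cast pp).
have := nr t; rewrite mem_iota tp => /(_ isT).
rewrite -ofZ_Fp_eq0 // -horner_cubicZ et => /eqP; apply.
rewrite /cubicZ !rmorphD /= map_polyXn map_polyZ /= map_polyX map_polyC /=.
rewrite !(hornerD, hornerZ, hornerXn, hornerX, hornerC).
apply: (mulfI (expf_neq0 3 dp)); rewrite mulr0 -[RHS]e /t.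
by field.
Qed.

(** Euler's criterion for odd p, with [b] marking a nonresidue; a multiple of an odd prime p fails
    for both values of [b]. *)
Definition legendre_ok (p : nat) (c : Z) (b : bool) : bool :=
  (Zpow_mod (c mod Z.of_nat p) (Z.of_nat p./2) (Z.of_nat p) =?
   (if b then -1 else 1) mod Z.of_nat p)%Zbin.

Lemma legendre_Fp p (c : Z) (b : bool) : prime p -> legendre_ok p c b ->
  ofZ 'F_p c ^+ p./2 = (-1) ^+ b.
Proof.
move=> pp /Z.eqb_spec; rewrite Zpow_mod_correct; last by have := prime_gt1 pp; lia.
move=> /(congr1 (ofZ 'F_p)); rewrite !ofZ_Fp_mod // ofZ_pow ofZ_Fp_mod // => ->.
by case: b; rewrite ?rmorph1 // -[X in ofZ _ X]/(- (1 : Z)) rmorphN1.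
Qed.

(** Scaling multiplies 4 a^3 + 27 b^2 by w^12, so smoothness can be tested on integers. *)
Lemma integral_model_smooth (W : weierstrass rat) (w : rat) (A B : Z) :
  w ^+ 4 * wa W = ofZ rat A -> w ^+ 6 * wb W = ofZ rat B ->
  4%:R * A ^+ 3 + 27%:R * B ^+ 2 != 0 -> discriminant W != 0.
Proof.
have push k l : ofZ rat (k%:R * A ^+ 3 + l%:R * B ^+ 2) =
    k%:R * ofZ rat A ^+ 3 + l%:R * ofZ rat B ^+ 2.
  by rewrite !(rmorphXn, rmorph_nat, rmorphD, rmorphM).
move=> wA wB; rewrite -(ofZ_eq0 rat) push -wA -wB.
apply: contraNneq => /eqP.
rewrite /discriminant mulf_eq0 oppr_eq0 pnatr_eq0 /= => /eqP e; apply/eqP.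
transitivity (w ^+ 12 * (4%:R * wa W ^+ 3 + 27%:R * wb W ^+ 2)); first by ring.
by rewrite e mulr0.
Qed.

(** * The rank certificate and its soundness *)

(* Bit i of xor_rows n rows is the sum over F_2 of the bits i of the rows
   selected by the bits of n. *)
Fixpoint xor_rows (n : Z) (rows : seq Z) : Z :=
  if rows is r :: rows' then Z.lxor (if Z.odd n then r else Z0) (xor_rows (Z.div2 n) rows')
  else Z0.

Lemma testbit_xor_rows (i : nat) (n : Z) (rows : seq Z) :
  Z.testbit (xor_rows n rows) (Z.of_nat i) = \big[addb/false]_(j < size rows)
    (Z.testbit n (Z.of_nat j) && Z.testbit (nth Z0 rows j) (Z.of_nat i)).
Proof.
elim: rows n => [|r rows IH] n; first by rewrite big_ord0 Z.testbit_0_l.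
have xorbE a b : xorb a b = a (+) b by case: a b => [] [].
rewrite big_ord_recl [xor_rows _ _]/= Z.lxor_spec IH xorbE; congr (_ (+) _).
  by rewrite -Z.bit0_odd; case: (Z.testbit n 0%Zbin); rewrite ?Z.testbit_0_l.
apply: eq_bigr => j _; rewrite Z.div2_spec Z.shiftr_spec; last exact: Zle_0_nat.
by rewrite Z.add_1_r -Nat2Z.inj_succ.
Qed.

(* An entry (p, (r1, r2, r3), bits) gives the three roots of the cubic modulo p,
   and bit i of bits tells whether xs_i - r1 is a nonresidue modulo p. *)
Definition character : Type := nat * (Z * Z * Z) * Z.

(** All three roots are checked to be distinct because [square_mod_reduction] needs the cubic to
    split; symbols are tested at the first root only. *)
Definition character_ok (A B : Z) (xs : seq Z) (c : character) : bool :=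
  let: (p, (r1, r2, r3), bits) := c in
  [&& prime p, odd p,
      all (fun r => cubic_val A B r mod Z.of_nat p =? 0)%Zbin [:: r1; r2; r3],
      all (fun d => ~~ (d mod Z.of_nat p =? 0))%Zbin [:: r1 - r2; r1 - r3; r2 - r3]%Zbin &
      all (fun i => legendre_ok p (nth Z0 xs i - r1)%Zbin (Z.testbit bits (Z.of_nat i)))
        (iota 0 (size xs))].

Definition invertible_ok (rows inverse : seq Z) : bool :=
  all (fun k => xor_rows (nth Z0 inverse k) rows =? 2 ^ Z.of_nat k)%Zbin
    (iota 0 (size rows)).

Definition point_ok (A B : Z) (P : Z * Z) : bool :=
  (P.2 * P.2 =? cubic_val A B P.1)%Zbin.

Section Certificate.
Variables (E : ellipticCurve rat) (w : rat) (A B : Z) (n : nat).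
Variables (pts : n.-tuple (Z * Z)) (chars : n.-tuple character) (inverse : seq Z).
Hypothesis w0 : w != 0.
Hypothesis wA : w ^+ 4 * wa E = ofZ rat A.
Hypothesis wB : w ^+ 6 * wb E = ofZ rat B.
Hypothesis no_root : forall x : rat, ~~ root (map_poly intr (cubicZ A B)) x.
Hypothesis pts_ok : all (point_ok A B) pts.
Hypothesis chars_ok : all (character_ok A B (unzip1 pts)) chars.
Hypothesis inverse_ok : invertible_ok (unzip2 chars) inverse.

Let pt (i : 'I_n) : Z * Z := tnth pts i.
Let bit (j i : 'I_n) : bool := Z.testbit (tnth chars j).2 (Z.of_nat i).

Lemma descent_cubicZ : descent_cubic E w = map_poly intr (cubicZ A B).
Proof.
rewrite /descent_cubic /cubicZ wA wB !rmorphD /= map_polyXn map_polyZ /= map_polyX.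
by rewrite map_polyC.
Qed.

Let no_root_descent x : ~~ root (descent_cubic E w) x.
Proof. by rewrite descent_cubicZ. Qed.

Lemma certified_pointP i :
  on_curve E (Some (ofZ rat (pt i).1 / w ^+ 2, ofZ rat (pt i).2 / w ^+ 3)).
Proof.
have /Z.eqb_spec := allP pts_ok _ (mem_tnth i pts).
rewrite -/(pt i); case: (pt i) => x y /= e.
have {e} : y * y = x * x * x + A * x + B := e.
move=> /(congr1 (ofZ rat)); rewrite !(rmorphD, rmorphM) /= -wA -wB => e.
rewrite expr_div_n expr2 e -exprM -[(3 * 2)%N]/6%N; apply/eqP.
by field.
Qed.

Definition certified_point i : point E := Point (certified_pointP i).

Lemma descent_certified_point i : descent w (certified_point i) = (ofZ rat (pt i).1)%:P - 'X.
Proof. by rewrite /descent /= mulrC divfK // expf_neq0. Qed.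

Lemma certified_character (m : 'I_n -> int) j :
  \sum_(i < n) certified_point i *~ m i = 0 ->
  ~~ \big[addb/false]_(i < n | ~~ (2 %| m i)%Z) bit j i.
Proof.
rewrite /bit; have := allP chars_ok _ (mem_tnth j chars).
case: (tnth chars j) => [[p [[r1 r2] r3]] bits] /and5P[pp op /allP rt /allP df /allP lg].
move=> /(descent_odd_part no_root_descent); rewrite descent_cubicZ.
pose u : {poly int} := \prod_(i < n | ~~ (2 %| m i)%Z) ((int_of_Z (pt i).1)%:P - 'X).
have -> : \prod_(i < n | ~~ (2 %| m i)%Z) descent w (certified_point i) = map_poly intr u.
  rewrite rmorph_prod; apply: eq_bigr => i _.
  by rewrite descent_certified_point rmorphB /= map_polyX map_polyC.
pose s := [:: ofZ 'F_p r1; ofZ 'F_p r2; ofZ 'F_p r3].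
move=> sq; have [z] : exists z, (map_poly intr u).[ofZ 'F_p r1] = z ^+ 2.
  apply: (square_mod_reduction (s := s) (cubicZ_size_monic A B).2 pp _ _ _ sq).
  - rewrite /= !inE negb_or -!(subr_eq0 (ofZ _ _)) -!rmorphB !ofZ_Fp_eq0 //.
    by rewrite !df // !inE eqxx ?orbT.
  - apply/allP => _ /(@mapP _ _ (ofZ 'F_p) [:: r1; r2; r3]) [r rs ->].
    by rewrite /root horner_cubicZ ofZ_Fp_eq0 // rt.
  - by rewrite (cubicZ_size_monic A B).1.
  - by rewrite inE eqxx.
rewrite rmorph_prod horner_prod => hz.
apply: (@euler_prod p p./2 _ _ (fun i => ofZ 'F_p ((pt i).1 - r1)) _ z) => //.
- by rewrite -[LHS]odd_double_half op.
- move=> i; apply: legendre_Fp => //.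
  have -> : (pt i).1 = nth Z0 (unzip1 pts) i.
    by rewrite (nth_map (Z0, Z0)) ?size_tuple // -tnth_nth.
  by apply: lg; rewrite mem_iota size_map size_tuple ltn_ord.
rewrite -hz; apply: eq_bigr => i _.
by rewrite rmorphB /= rmorphB /= map_polyX map_polyC /= !hornerE.
Qed.

Lemma bit_inverse (k i : 'I_n) : \big[addb/false]_(j < n)
  (Z.testbit (nth Z0 inverse k) (Z.of_nat j) && bit j i) = (k == i).
Proof.
have := allP inverse_ok k; rewrite mem_iota size_map size_tuple ltn_ord => /(_ isT).
move=> /Z.eqb_spec /(congr1 (Z.testbit ^~ (Z.of_nat i))).
rewrite testbit_xor_rows Z.pow2_bits_eqb; last exact: Zle_0_nat.
rewrite size_map size_tuple => e; transitivity (Z.eqb (Z.of_nat k) (Z.of_nat i)).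
  rewrite -e; apply: eq_bigr => j _; rewrite /bit (tnth_nth (0%N, (Z0, Z0, Z0), Z0)).
  by rewrite (nth_map (0%N, (Z0, Z0, Z0), Z0)) ?size_tuple.
by rewrite -val_eqE; apply/Z.eqb_spec/eqP => [/Nat2Z.inj|->].
Qed.

Lemma rank_certificate : rank_at_least n (point E).
Proof.
exists certified_point; apply: Z_independent_of_even; first exact: no_2_torsion no_root_descent.
move=> m m0 k.
(* Every character vanishes on the parity vector of [m]; row [k] of [inverse] combines them into the
   parity of [m k], so the double sum below is computed in both orders. *)
pose N j := Z.testbit (nth Z0 inverse k) (Z.of_nat j).
have : \big[addb/false]_(i < n | ~~ (2 %| m i)%Z)
    \big[addb/false]_(j < n) (N j && bit j i) = false.
  rewrite exchange_big /= big1 // => j _.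
  by rewrite -big_distrr /= (negPf (certified_character j m0)) andbF.
under eq_bigr => i _ do rewrite bit_inverse.
have [//|mk] := boolP (2 %| m k)%Z.
by rewrite (bigD1 k) //= eqxx big1 // => i /andP[_ /negPf]; rewrite eq_sym.
Qed.

End Certificate.

(** * Clearing denominators in polynomial values *)

Section EvalFraction.
Variables (n d : Z).
Hypothesis d0 : ofZ rat d != 0.
Let t := ofZ rat n / ofZ rat d.

Lemma fraction_term (k N : nat) (c : Z) : (k <= N)%N ->
  ofZ rat c * t ^+ k * ofZ rat d ^+ N = ofZ rat (c * n ^+ k * d ^+ (N - k)).
Proof.
move=> kN; rewrite -{1}(subnK kN) exprD !rmorphM !rmorphXn expr_div_n mulrACA.
by rewrite -!mulrA [_ ^+ (N - k) * _]mulrC mulrA divfK ?expf_neq0 // mulrA.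
Qed.

Lemma evalZ_deg8 (c0 c1 c2 c3 c4 c5 c6 c7 c8 : Z) :
  evalZ (c8 *: 'X^8 + c7 *: 'X^7 + c6 *: 'X^6 + c5 *: 'X^5 + c4 *: 'X^4 +
         c3 *: 'X^3 + c2 *: 'X^2 + c1 *: 'X + c0%:P) t * ofZ rat d ^+ 8
  = ofZ rat (c8 * n ^+ 8 * d ^+ 0 + c7 * n ^+ 7 * d ^+ 1 + c6 * n ^+ 6 * d ^+ 2 +
     c5 * n ^+ 5 * d ^+ 3 + c4 * n ^+ 4 * d ^+ 4 + c3 * n ^+ 3 * d ^+ 5 +
     c2 * n ^+ 2 * d ^+ 6 + c1 * n ^+ 1 * d ^+ 7 + c0 * n ^+ 0 * d ^+ 8).
Proof.
rewrite /evalZ -[map_poly _]/(map_poly (ofZ rat)).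
rewrite !rmorphD /= !map_polyZ /= !map_polyXn map_polyX map_polyC /=.
rewrite !(hornerD, hornerZ, hornerXn, hornerX, hornerC) -/t.
(* The last two terms are written with t^1 and t^0 so that [fraction_term] applies to all of
   them. *)
rewrite -[X in ofZ rat c1 * X](expr1 t) -[ofZ rat c0]mulr1 -[X in ofZ rat c0 * X](expr0 t).
by rewrite !mulrDl !fraction_term.
Qed.

Lemma evalZ_deg12 (c0 c1 c2 c3 c4 c5 c6 c7 c8 c9 c10 c11 c12 : Z) :
  evalZ (c12 *: 'X^12 + c11 *: 'X^11 + c10 *: 'X^10 + c9 *: 'X^9 +
         c8 *: 'X^8 + c7 *: 'X^7 + c6 *: 'X^6 + c5 *: 'X^5 + c4 *: 'X^4 +
         c3 *: 'X^3 + c2 *: 'X^2 + c1 *: 'X + c0%:P) t * ofZ rat d ^+ 12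
  = ofZ rat (c12 * n ^+ 12 * d ^+ 0 + c11 * n ^+ 11 * d ^+ 1 + c10 * n ^+ 10 * d ^+ 2 +
     c9 * n ^+ 9 * d ^+ 3 + c8 * n ^+ 8 * d ^+ 4 + c7 * n ^+ 7 * d ^+ 5 +
     c6 * n ^+ 6 * d ^+ 6 + c5 * n ^+ 5 * d ^+ 7 + c4 * n ^+ 4 * d ^+ 8 +
     c3 * n ^+ 3 * d ^+ 9 + c2 * n ^+ 2 * d ^+ 10 + c1 * n ^+ 1 * d ^+ 11 +
     c0 * n ^+ 0 * d ^+ 12).
Proof.
rewrite /evalZ -[map_poly _]/(map_poly (ofZ rat)).
rewrite !rmorphD /= !map_polyZ /= !map_polyXn map_polyX map_polyC /=.
rewrite !(hornerD, hornerZ, hornerXn, hornerX, hornerC) -/t.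
rewrite -[X in ofZ rat c1 * X](expr1 t) -[ofZ rat c0]mulr1 -[X in ofZ rat c0 * X](expr0 t).
by rewrite !mulrDl !fraction_term.
Qed.

End EvalFraction.

(** * The fiber and its numerical certificate *)

Definition t0 : rat := ofZ rat (-9529)%Zbin / ofZ rat 5471%Zbin.

(* The scaling x |-> w0^2 x, y |-> w0^3 y makes the fiber integral. *)
Definition w0 : rat := ofZ rat 5471%Zbin ^+ 2.

Lemma denominator_neq0 : ofZ rat 5471%Zbin != 0.
Proof. by rewrite ofZ_eq0. Qed.

Lemma w0_neq0 : w0 != 0.
Proof. exact: expf_neq0 denominator_neq0. Qed.

(* -27 c4 and -54 c6 of the minimal model of Elkies's curve. *)
Definition curveA : Z := (-26007820090585882454203037839302751405205578484583927626187)%Zbin.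
Definition curveB : Z :=
  (1608774079908945642525890980136799068994005997940568338381502120424946520558796200800134)%Zbin.

(** The degrees 8 and 12 of S and T match [w0 ^+ 4] and [w0 ^+ 6], which are the powers 8 and 12 of
    the denominator of [t0]; this leaves an identity of integers. *)
Lemma fiber_wa : w0 ^+ 4 * wa (fiber t0) = ofZ rat curveA.
Proof.
rewrite -[wa _]/(- 27%:R * evalZ polyS _) -exprM mulrCA [X in _ * X]mulrC.
rewrite /polyS (evalZ_deg8 _ denominator_neq0) -[27%:R](rmorph_nat (ofZ rat)) -rmorphN -rmorphM.
by apply: (congr1 (ofZ rat)); apply/eqP; vm_compute.
Qed.

Lemma fiber_wb : w0 ^+ 6 * wb (fiber t0) = ofZ rat curveB.
Proof.
rewrite -[wb _]/(27%:R / 4%:R * evalZ polyT _) -exprM mulrCA [X in _ * X]mulrC.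
rewrite /polyT (evalZ_deg12 _ denominator_neq0).
have quotient k l (x y : Z) : l.+1%:R * y = k%:R * x ->
    k%:R / l.+1%:R * ofZ rat x = ofZ rat y.
  move=> /(congr1 (ofZ rat)); rewrite !rmorphM !rmorph_nat => e.
  by rewrite mulrAC -e mulrAC mulfV ?mul1r ?pnatr_eq0.
by apply: quotient; apply/eqP; vm_compute.
Qed.

Lemma fiber_smooth : discriminant (fiber t0) != 0.
Proof. by apply: integral_model_smooth fiber_wa fiber_wb _; vm_compute. Qed.

(* Elkies's generators, on the minimal model
   y^2 + x y + y = x^3 - x^2
     - 20067762415575526585033208209338542750930230312178956502 x
     + 34481611795030556467032985690390720374855944359319180361266008296291939448732243429,
   from which short_points are obtained by completing the square and the cube. *)
Definition elkies_points : 28.-tuple (Z * Z) := [tuple of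
  [:: (-2124150091254381073292137463, 259854492051899599030515511070780628911531);
    (2334509866034701756884754537, 18872004195494469180868316552803627931531);
    (-1671736054062369063879038663, 251709377261144287808506947241319126049131);
    (2139130260139156666492982137, 36639509171439729202421459692941297527531);
    (1534706764467120723885477337, 85429585346017694289021032862781072799531);
    (-2731079487875677033341575063, 262521815484332191641284072623902143387531);
    (2775726266844571649705458537, 12845755474014060248869487699082640369931);
    (1494385729327188957541833817, 88486605527733405986116494514049233411451);
    (1868438228620887358509065257, 59237403214437708712725140393059358589131);
    (2008945108825743774866542537, 47690677880125552882151750781541424711531);
    (2348360540918025169651632937, 17492930006200557857340332476448804363531);
    (-1472084007090481174470008663, 246643450653503714199947441549759798469131);
    (2924128607708061213363288937, 28350264431488878501488356474767375899531);
    (5374993891066061893293934537, 286188908427263386451175031916479893731531);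
    (1709690768233354523334008557, 71898834974686089466159700529215980921631);
    (2450954011353593144072595187, 4445228173532634357049262550610714736531);
    (2969254709273559167464674937, 32766893075366270801333682543160469687531);
    (2711914934941692601332882937, 2068436612778381698650413981506590613531);
    (20078586077996854528778328937, 2779608541137806604656051725624624030091531);
    (2158082450240734774317810697, 34994373401964026809969662241800901254731);
    (2004645458247059022403224937, 48049329780704645522439866999888475467531);
    (2975749450947996264947091337, 33398989826075322320208934410104857869131);
    (-2102490467686285150147347863, 259576391459875789571677393171687203227531);
    (311583179915063034902194537, 168104385229980603540109472915660153473931);
    (2773931008341865231443771817, 12632162834649921002414116273769275813451);
    (2156581188143768409363461387, 35125092964022908897004150516375178087331);
    (3866330499872412508815659137, 121197755655944226293036926715025847322531);
    (2230868289773576023778678737, 28558760030597485663387020600768640028531)]%Zbin].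

(** The standard substitution X = 36 x + 3 b2, Y = 108 (2 y + a1 x + a3), here with b2 = -3 and a1 =
    a3 = 1. *)
Definition short_points : 28.-tuple (Z * Z) :=
  map_tuple (fun P => (36 * P.1 - 9, 108 * (2 * P.2 + P.1 + 1))%Zbin) elkies_points.

(** A prime serves with at most two of its roots: the product of x - r over the three roots is y^2,
    so the third symbol is determined by the others. *)
Definition elkies_characters : 28.-tuple character := [tuple of
  [:: (59%N, (6, 19, 34), 214454481);
    (59%N, (19, 6, 34), 109409150);
    (131%N, (22, 119, 121), 252843487);
    (131%N, (119, 22, 121), 31769981);
    (211%N, (37, 71, 103), 131162161);
    (211%N, (71, 37, 103), 14244916);
    (251%N, (55, 93, 103), 99652978);
    (251%N, (93, 55, 103), 207573835);
    (271%N, (28, 99, 144), 232595003);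
    (271%N, (99, 28, 144), 133921966);
    (337%N, (53, 289, 332), 246443777);
    (337%N, (289, 53, 332), 223030331);
    (373%N, (200, 225, 321), 55908390);
    (373%N, (225, 200, 321), 123762337);
    (409%N, (195, 226, 397), 213076282);
    (409%N, (226, 195, 397), 96082787);
    (433%N, (203, 309, 354), 126177518);
    (433%N, (309, 203, 354), 264235440);
    (541%N, (183, 429, 470), 9793192);
    (541%N, (429, 183, 470), 241314485);
    (547%N, (69, 505, 520), 157760066);
    (547%N, (505, 69, 520), 255870357);
    (557%N, (11, 183, 363), 30116968);
    (557%N, (183, 11, 363), 45954003);
    (577%N, (306, 291, 557), 129375847);
    (641%N, (35, 68, 538), 106276125);
    (659%N, (485, 235, 598), 217051688);
    (769%N, (337, 7, 425), 31096877)]%Zbin].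

(* The bits of row k select the characters whose sum is the k-th coordinate
   functional on F_2^28. *)
Definition inverse_rows : seq Z :=
  [:: 122327676; 234639937; 205121243; 132615289;
    222398817; 92572345; 189385773; 1073061;
    163211882; 23570082; 89604310; 84558625;
    172426088; 205933275; 248058375; 240162804;
    150020772; 240476249; 182033138; 4928347;
    14064089; 138227158; 192936702; 54297955;
    164319445; 189195726; 266975379; 37580206]%Zbin.

Lemma short_points_ok : all (point_ok curveA curveB) short_points.
Proof. by vm_compute. Qed.

Lemma elkies_characters_ok :
  all (character_ok curveA curveB (unzip1 short_points)) elkies_characters.
Proof. by vm_compute. Qed.

Lemma inverse_rows_ok : invertible_ok (unzip2 elkies_characters) inverse_rows.
Proof. by vm_compute. Qed.

Lemma curve_no_root_mod_23 : no_root_mod curveA curveB 23.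
Proof. by vm_compute. Qed.

Theorem theorem2 :
  exists (t : rat) (E : ellipticCurve rat),
    ec_weierstrass E = fiber t /\ rank_at_least 28 (point E).
Proof.
exists t0, (EllipticCurve fiber_smooth); split=> //.
apply: (@rank_certificate _ w0 curveA curveB 28 short_points elkies_characters inverse_rows).
- exact: w0_neq0.
- exact: fiber_wa.
- exact: fiber_wb.
- exact: (@cubicZ_no_rat_root 23 _ _ isT curve_no_root_mod_23).
- exact: short_points_ok.
- exact: elkies_characters_ok.
- exact: inverse_rows_ok.
Qed.
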